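(* Let $k,D\ge 1$ be integers, let $P_1,\ldots,P_k\in\mathbb{Q}(x_1,\ldots,x_k)$ be rational functions of degree at most $D$, and let $F^{(i)}_n\in\mathbb{Q}(x_1,\ldots,x_k)$ ($1\le i\le k$, $n\in\mathbb{N}$) be defined by $F^{(i)}_0=x_i$ and $F^{(i)}_{n+1}=P_i(F^{(1)}_n,\ldots,F^{(k)}_n)$, where it is assumed that all these right-hand sides are well-defined for all $n\in\mathbb{N}$. Then there exist $m\in\mathbb{N}$ and a rational function $R\in\mathbb{Q}(y_0,\ldots,y_m)$ such that $$F^{(1)}_{n+m+1}=R\bigl(F^{(1)}_n,F^{(1)}_{n+1},\ldots,F^{(1)}_{n+m}\bigr)\quad\text{for all } n\in\mathbb{N}.$$ Moreover, $m$ can be bounded from above by $k+k^3\log_2(kD)$.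
   Context: $\mathbb{N}$ denotes the nonnegative integers. The degree of a polynomial in several variables is its total degree; the degree of a rational function is the maximum of the degrees of its numerator and its denominator. The right-hand side $P_i(F^{(1)}_n,\ldots,F^{(k)}_n)$ is well-defined when the denominator of $P_i$ does not become the zero element of $\mathbb{Q}(x_1,\ldots,x_k)$ after the substitution $x_j\mapsto F^{(j)}_n$. All equalities are equalities in the field $\mathbb{Q}(x_1,\ldots,x_k)$. *)

(* Defs.v *)
From Stdlib Require Import Reals.
From HB Require Import structures.
From mathcomp Require Import all_boot all_order all_algebra.
From mathcomp Require Import mpoly.
Set Implicit Arguments. Unset Strict Implicit. Unset Printing Implicit Defensive.
Import Order.TTheory GRing.Theory Num.Theory.
Local Open Scope ring_scope.

(* Algebra is done in MathComp (%R is ring_scope); Stdlib's concrete reals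
   occur only in the bound on the order of the recursion and are delimited by
   %coqR. *)
Delimit Scope R_scope with coqR.

Notation ratpoly n := {mpoly rat[n]}.
Notation ratfun n := {fraction {mpoly rat[n]}}.

Definition ratfun_of n (p : ratpoly n) : ratfun n := FracField.tofrac p.

Definition ratfun_const n (c : rat) : ratfun n := ratfun_of c%:MP.

Definition ratfun_var n (i : 'I_n) : ratfun n := ratfun_of 'X_i.

Definition poly_divides n (d p : ratpoly n) : Prop := exists e, p = e * d.

(* The MathComp coprimality predicates are for univariate polynomials only. *)
Definition poly_coprime n (p q : ratpoly n) : Prop :=
  forall d, poly_divides d p -> poly_divides d q -> d \is a GRing.unit.

(* p and q are the numerator and the denominator of f, which are unique up to
   a common nonzero constant factor. *)
Definition lowest_terms n (f : ratfun n) (p q : ratpoly n) : Prop :=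
  [/\ q != 0, poly_coprime p q & f = ratfun_of p / ratfun_of q].

(* msize is 1 + the total degree, and 0 for the zero polynomial, which is
   thus given degree 0 here. *)
Definition total_degree n (p : ratpoly n) : nat := (msize p).-1.

(* The degree of the rational function with numerator p and denominator q. *)
Definition ratfun_degree n (p q : ratpoly n) : nat :=
  maxn (total_degree p) (total_degree q).

(* p(v_1, ..., v_l), for v_1, ..., v_l rational functions in n variables. *)
Definition poly_subst l n (v : 'I_l -> ratfun n) (p : ratpoly l) : ratfun n :=
  mmap (@ratfun_const n) v p.

Definition log2 (x : R) : R := (ln x / ln 2)%coqR.

(* Main.v *)
Require Import Defs.
From Stdlib Require Import Reals.
From HB Require Import structures.
From mathcomp Require Import all_boot all_order all_algebra.
From mathcomp Require Import mpoly.
From mathcomp Require Import ring zify.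
From Stdlib Require Import Classical ClassicalEpsilon Lra.
Set Implicit Arguments. Unset Strict Implicit. Unset Printing Implicit Defensive.
Import Order.TTheory GRing.Theory Num.Theory.
Local Open Scope ring_scope.

(* Write f_n for the first coordinate of F_n and q for kD, so that F_n has a
   common denominator and numerators of degree at most q^n. The substitution
   theta : x |-> F_1 is an endomorphism, with theta f_n = f_(n+1), of the ring A
   of the fractions whose denominator does not vanish at any F_n. If theta is
   not injective on theta^s(A), then theta^(s+1)(A) has a smaller transcendence
   degree than theta^s(A); hence theta is injective on theta^S(A) for some S
   such that S plus the transcendence degree of theta^S(A) is at most k.
   Put g_i = f_(S+i), and let d be least such that g_d is algebraic over
   Q[g_0, ..., g_(d-1)]. Injectivity transports relations along the orbit, so
   all the g_i are algebraic over g_0, ..., g_(d-1). If g_(d+i) is not in the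
   field Q(g_0, ..., g_(d+i-1)) for i < L, then the products of the g_(d+i) over
   the 2^L subsets of the i < L are linearly independent over the field generated
   by g_0, ..., g_(d-1) and k - d suitable variables x_j, a transcendence basis.
   Counting the monomials with exponents below N in this basis, times these
   products, against polynomials of bounded degree in k variables gives
   2^L N^k <= (k q^k N + O(1))^k, hence 2^L <= (k q^k)^k <= q^(k^3). *)

(** * Finitely generated subrings and derivations *)

Section Adjunction.
Variables (K : fieldType) (c : {rmorphism rat -> K}).

(* [adj s] is the subring Q[s], each element being a polynomial in the head of
   [s] over the subring generated by the tail. *)
Fixpoint adj (s : seq K) : K -> Prop :=
  if s is z :: s' then
    fun x => exists2 p : {poly K}, (forall i, adj s' p`_i) & x = p.[z]
  else fun x => exists a, x = c a.

Definition transcendental (R : K -> Prop) (z : K) : Prop :=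
  forall p : {poly K}, (forall i, R p`_i) -> p.[z] = 0 -> p = 0.

(** Algebraic independence over the rationals in triangular form: each entry is tested against the
    ring of the later ones, so families grow by one transcendental head at a time. *)
Fixpoint indep (s : seq K) : Prop :=
  if s is z :: s' then indep s' /\ transcendental (adj s') z else True.

Lemma adj_cst s a : adj s (c a).
Proof.
elim: s a => [|z s IH] a /=; first by exists a.
exists (c a)%:P; last by rewrite hornerC.
by move=> i; rewrite coefC; case: eqP => // _; rewrite -(rmorph0 c).
Qed.

Lemma adj0 s : adj s 0.
Proof. by rewrite -(rmorph0 c); exact: adj_cst. Qed.

(** Both closures share one induction: the coefficients of a product are sums of products over the
    tail. *)
Lemma adjDM s x y : adj s x -> adj s y -> adj s (x + y) /\ adj s (x * y).
Proof.
elim: s x y => [|z s IH] x y /=.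
  by move=> [a ->] [b ->]; split; [exists (a + b); rewrite rmorphD|exists (a * b); rewrite rmorphM].
move=> [p hp ->] [q hq ->]; split.
  by exists (p + q) => [i|]; rewrite ?hornerD // coefD; case: (IH _ _ (hp i) (hq i)).
exists (p * q) => [i|]; rewrite ?hornerM // coefM.
elim/big_ind: _ => [|a b ha hb|j _]; first exact: adj0.
- by case: (IH _ _ ha hb).
- by case: (IH _ _ (hp j) (hq (i - j)%N)).
Qed.

Lemma adjD s x y : adj s x -> adj s y -> adj s (x + y).
Proof. by move=> hx hy; case: (adjDM hx hy). Qed.

Lemma adjM s x y : adj s x -> adj s y -> adj s (x * y).
Proof. by move=> hx hy; case: (adjDM hx hy). Qed.

Lemma adjX s x n : adj s x -> adj s (x ^+ n).
Proof.
move=> hx; elim: n => [|n IH]; last by rewrite exprS; apply: adjM.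
by rewrite expr0 -(rmorph1 c); apply: adj_cst.
Qed.

Lemma adj_behead z s x : adj s x -> adj (z :: s) x.
Proof.
move=> hx /=; exists x%:P; last by rewrite hornerC.
by move=> i; rewrite coefC; case: eqP => // _; apply: adj0.
Qed.

Lemma adj_head z s : adj (z :: s) z.
Proof.
exists 'X; last by rewrite hornerX.
by move=> i; rewrite coefX -(rmorph_nat c); apply: adj_cst.
Qed.

Lemma adj_ind (T : K -> Prop) (s : seq K) :
  (forall a, T (c a)) -> (forall x y, T x -> T y -> T (x + y)) ->
  (forall x y, T x -> T y -> T (x * y)) -> (forall z, z \in s -> T z) ->
  forall x, adj s x -> T x.
Proof.
move=> Tc TD TM; elim: s => [|z s IH] Ts x /=; first by move=> [a ->].
move=> [p hp ->]; rewrite horner_coef.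
have {}IH := IH (fun y hy => Ts y (mem_behead (s := z :: s) hy)).
elim/big_ind: _ => [|//|i _]; first by rewrite -(rmorph0 c).
apply: (TM); first exact: IH.
elim: (nat_of_ord i) => [|n IHn]; first by rewrite expr0 -(rmorph1 c).
by rewrite exprS; apply: TM => //; apply: Ts; rewrite inE eqxx.
Qed.

Lemma natr_field_neq0 n : n.+1%:R != 0 :> K.
Proof. by rewrite -(rmorph_nat c) fmorph_eq0 pnatr_eq0. Qed.

Definition derivation (D : K -> K) : Prop :=
  [/\ forall a, D (c a) = 0, forall x y, D (x + y) = D x + D y
    & forall x y, D (x * y) = D x * y + x * D y].

Lemma derivation_horner D (p : {poly K}) z : derivation D -> (forall i, D p`_i = 0) ->
  D p.[z] = p^`().[z] * D z.
Proof.
move=> [Dc DD DM]; elim/poly_ind: p => [|p a IH] hp.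
  by rewrite deriv0 !horner0 mul0r -{1}(rmorph0 c) Dc.
have ha : D a = 0 by have := hp 0%N; rewrite coefD coefMX coefC eqxx add0r.
have {}IH : D p.[z] = p^`().[z] * D z.
  by apply: IH => i; have := hp i.+1; rewrite coefD coefMX coefC /= addr0.
rewrite derivMXaddC !hornerE DD DM IH ha; ring.
Qed.

(* Differentiating a relation of least degree yields a smaller one. *)
Lemma transcendental_derivation D z : derivation D -> D z != 0 ->
  transcendental (fun x => D x = 0) z.
Proof.
move=> hD Dz p; have [Dc DD DM] := hD.
have [n] := ubnP (size p); elim: n p => // n IH p hn hp pz.
have dz : p^`().[z] = 0.
  apply/eqP; have := derivation_horner z hD hp.
  rewrite pz -{1}(rmorph0 c) Dc => /esym/eqP.
  by rewrite mulf_eq0 (negPf Dz) orbF.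
have dM m x : D x = 0 -> D (x *+ m) = 0.
  move=> hx; elim: m => [|m IHm]; first by rewrite mulr0n -{1}(rmorph0 c) Dc.
  by rewrite mulrS DD hx IHm addr0.
have dp : p^`() = 0.
  have [-> | p0] := eqVneq p 0; first by rewrite deriv0.
  apply: IH => // [|i]; last by rewrite coef_deriv; apply: dM.
  by apply: leq_trans (lt_size_deriv p0) _.
have {dp} hc i : p`_i.+1 = 0.
  have /eqP := congr1 (fun q : {poly K} => q`_i) dp.
  by rewrite coef_deriv coef0 -mulr_natr mulf_eq0 (negPf (natr_field_neq0 i)) orbF => /eqP.
have p_cst : p = (p`_0)%:P by apply/polyP => [[|i]]; rewrite coefC //= hc.
by move: pz; rewrite p_cst hornerC => ->.
Qed.

End Adjunction.

(** * Specialization and transcendence degree *)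

Lemma least_nat (P : nat -> Prop) :
  (exists n, P n) -> exists2 n, P n & forall m, (m < n)%N -> ~ P m.
Proof.
move=> [n]; have [j] := ubnP n; elim: j n => // j IH n hn Pn.
have [[m [mn Pm]]|none] := classic (exists m, (m < n)%N /\ P m).
  by apply: (IH m) => //; apply: leq_trans mn _.
by exists n => // m mn Pm; apply: none; exists m.
Qed.

Section Specialization.
Variables (K : fieldType) (c : {rmorphism rat -> K}) (A : K -> Prop).
Hypothesis A_cst : forall a, A (c a).
Hypothesis A_add : forall x y, A x -> A y -> A (x + y).
Hypothesis A_mul : forall x y, A x -> A y -> A (x * y).

(** A substitution makes sense only where denominators survive, so [f] is a total function with
    nothing required of it outside [A]. *)
Definition hom_on (f : K -> K) : Prop :=
  [/\ forall a, f (c a) = c a, forall x y, A x -> A y -> f (x + y) = f x + f y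
    & forall x y, A x -> A y -> f (x * y) = f x * f y].

Lemma A0 : A 0.
Proof. by rewrite -(rmorph0 c); exact: A_cst. Qed.

Lemma hom0 f : hom_on f -> f 0 = 0.
Proof. by move=> [fc _ _]; rewrite -(rmorph0 c) fc. Qed.

Lemma adj_sub (l : seq K) x : (forall z, z \in l -> A z) -> adj c l x -> A x.
Proof. by move=> hl; apply: adj_ind. Qed.

Lemma horner_A (p : {poly K}) z : (forall i, A p`_i) -> A z -> A p.[z].
Proof.
move=> hp Az; elim/poly_ind: p hp => [|p a IH] hp; first by rewrite horner0; apply: A0.
rewrite hornerMXaddC; apply: A_add.
  apply: A_mul => //; apply: IH => i.
  by have := hp i.+1; rewrite coefD coefMX coefC /= addr0.
by have := hp 0%N; rewrite coefD coefMX coefC eqxx add0r.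
Qed.

Lemma hom_horner f (p : {poly K}) z : hom_on f -> (forall i, A p`_i) -> A z ->
  f p.[z] = (map_poly f p).[f z].
Proof.
move=> hf hp Az; have [fc fD fM] := hf.
have f0 := hom0 hf.
elim/poly_ind: p hp => [|p a IH] hp.
  by rewrite horner0 map_poly0 horner0.
have hp' i : A p`_i by have := hp i.+1; rewrite coefD coefMX coefC /= addr0.
have ha : A a by have := hp 0%N; rewrite coefD coefMX coefC eqxx add0r.
have -> : map_poly f (p * 'X + a%:P) = map_poly f p * 'X + (f a)%:P.
  apply/polyP => i; rewrite coef_map_id0 // !coefD !coefMX !coefC.
  by case: i => [|i] /=; rewrite ?add0r ?addr0 ?coef_map_id0.
rewrite !hornerMXaddC fD //; last by apply: A_mul => //; apply: horner_A.
by rewrite fM ?IH //; apply: horner_A.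
Qed.

Lemma adj_hom f (l : seq K) x : hom_on f -> (forall z, z \in l -> A z) ->
  adj c l x -> adj c (map f l) (f x).
Proof.
move=> hf; elim: l x => [|z l IH] x hl /=.
  by move=> [a ->]; have [fc _ _] := hf; exists a.
move=> [p hp ->].
have hl' y : y \in l -> A y by move=> yl; apply: hl; rewrite inE yl orbT.
exists (map_poly f p) => [i|].
  by rewrite coef_map_id0 ?(hom0 hf) //; apply: IH.
apply: hom_horner => // [i|]; first exact: adj_sub (hp i).
by apply: hl; rewrite inE eqxx.
Qed.

(** Applying [f] to a relation gives a relation between the images. Their independence kills the
    mapped coefficients, and injectivity on the tail ring, carried along in the induction, kills the
    coefficients themselves. *)
Lemma indep_hom f (l : seq K) : hom_on f -> (forall z, z \in l -> A z) ->
  indep c (map f l) ->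
  indep c l /\ (forall x, adj c l x -> f x = 0 -> x = 0).
Proof.
move=> hf; have f0 := hom0 hf.
elim: l => [|z l IH] hl /=.
  move=> _; split => // x [a ->]; have [fc _ _] := hf.
  by rewrite fc.
move=> [il tz].
have hl' y : y \in l -> A y by move=> yl; apply: hl; rewrite inE yl orbT.
have Az : A z by apply: hl; rewrite inE eqxx.
have {IH} [il' injl] := IH hl' il.
have key (p : {poly K}) : (forall i, adj c l p`_i) -> f p.[z] = 0 -> p = 0.
  move=> hp; rewrite hom_horner // => [pz|i]; last exact: adj_sub (hp i).
  have mp0 : map_poly f p = 0.
    by apply: tz pz => i; rewrite coef_map_id0 //; apply: adj_hom.
  apply/polyP => i; rewrite coef0; apply: injl => //.
  by have := congr1 (fun q : {poly K} => q`_i) mp0; rewrite coef_map_id0 // coef0.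
split; first by split=> // p hp pz; apply: key; rewrite // pz.
by move=> x [p hp ->] /(key _ hp) ->; rewrite horner0.
Qed.

(* A relation [p(h) = 0] over [Q[l]] specializes to [f (p 0) = 0], so that
   [p 0 = 0] and the relation can be divided by [h]. *)
Lemma indep_hom_ker f (l : seq K) h : hom_on f -> (forall z, z \in l -> A z) ->
  indep c (map f l) -> A h -> h != 0 -> f h = 0 -> indep c (h :: l).
Proof.
move=> hf hl ifl Ah h0 fh; have [il injl] := indep_hom hf hl ifl.
split => // p; elim/poly_ind: p => // p a IH hp.
have [fc fD fM] := hf.
have hp' i : adj c l p`_i by have := hp i.+1; rewrite coefD coefMX coefC /= addr0.
have ha : adj c l a by have := hp 0%N; rewrite coefD coefMX coefC eqxx add0r.
rewrite hornerMXaddC => pa0.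
have Ap : A p.[h] by apply: horner_A => // i; apply: adj_sub (hp' i).
have a0 : a = 0.
  apply: injl => //; have := congr1 f pa0.
  rewrite fD ?fM ?fh ?mulr0 ?add0r ?(hom0 hf) //; first exact: A_mul.
  exact: adj_sub ha.
move: pa0; rewrite a0 addr0 => /eqP; rewrite mulf_eq0 (negPf h0) orbF => /eqP /IH -> //.
by rewrite mul0r addr0.
Qed.

Variable theta : K -> K.
Hypothesis theta_hom : hom_on theta.
Hypothesis theta_A : forall x, A x -> A (theta x).

Lemma iter_A n x : A x -> A (iter n theta x).
Proof. by move=> Ax; elim: n => //= n; apply: theta_A. Qed.

Lemma iter_hom n : hom_on (iter n theta).
Proof.
elim: n => [|n [ic iD iM]]; first by split.
have [tc tD tM] := theta_hom; split => [a|x y Ax Ay|x y Ax Ay] /=.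
- by rewrite ic tc.
- by rewrite iD // tD //; apply: iter_A.
- by rewrite iM // tM //; apply: iter_A.
Qed.

Definition img n x : Prop := exists2 y, A y & x = iter n theta y.

Definition inj_on_img n : Prop := forall x, img n x -> theta x = 0 -> x = 0.

Lemma img_A n x : img n x -> A x.
Proof. by move=> [y Ay ->]; apply: iter_A. Qed.

Lemma img_theta n x : img n x -> img n (theta x).
Proof. by move=> [y Ay ->]; exists (theta y); [apply: theta_A | rewrite -iterS iterSr]. Qed.

Lemma img_ring n : [/\ forall a, img n (c a),
  forall x y, img n x -> img n y -> img n (x + y)
  & forall x y, img n x -> img n y -> img n (x * y)].
Proof.
have [ic iD iM] := iter_hom n; split => [a|x y|x y].
- by exists (c a).
- by move=> [a Aa ->] [b Ab ->]; exists (a + b); rewrite ?iD //; apply: A_add.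
- by move=> [a Aa ->] [b Ab ->]; exists (a * b); rewrite ?iM //; apply: A_mul.
Qed.

Lemma img_iter_inj n j x : inj_on_img n -> img n x -> iter j theta x = 0 -> x = 0.
Proof.
move=> hn; elim: j x => [|j IH] x //; rewrite iterSr => hx /IH h.
by apply: hn => //; apply: h; apply: img_theta.
Qed.

Lemma map_img n (l : seq K) : (forall z, z \in l -> img n.+1 z) ->
  exists2 l', l = map theta l' & forall z, z \in l' -> img n z.
Proof.
elim: l => [|z l IH] hl; first by exists [::].
have [|l' -> hl'] := IH; first by move=> y yl; apply: hl; rewrite inE yl orbT.
have [|y Ay ->] := hl z; first by rewrite inE eqxx.
exists (iter n theta y :: l') => // x; rewrite inE => /orP[/eqP ->|/hl' //].
by exists y.
Qed.

(** At each level where injectivity fails, lifting the family one level down and adding a kernel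
    element gives a longer independent family, by [indep_hom_ker]. *)
Lemma img_trdeg_bound k n : (forall l, indep c l -> (size l <= k)%N) ->
  (forall m, (m < n)%N -> ~ inj_on_img m) ->
  forall l, indep c l -> (forall z, z \in l -> img n z) -> (size l + n <= k)%N.
Proof.
move=> hk; elim: n => [|n IH] hn l il hl; first by rewrite addn0; apply: hk.
have [l' l_def hl'] := map_img hl.
have [x [hx [tx /eqP x0]]] : exists x, img n x /\ theta x = 0 /\ x <> 0.
  apply: NNPP => none; apply: (hn n (ltnSn n)) => x hx tx.
  by apply: NNPP => x0; apply: none; exists x.
have := IH (fun m mn => hn m (leqW mn)) (x :: l').
rewrite /= l_def size_map addSnnS; apply.
  apply: (indep_hom_ker theta_hom); rewrite -?l_def //; last exact: img_A hx.
  by move=> z /hl'; apply: img_A.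
by move=> z; rewrite inE => /orP[/eqP ->|/hl' //].
Qed.

Lemma exists_inj_on_img k : (forall l, indep c l -> (size l <= k)%N) ->
  exists n, inj_on_img n /\
    forall l, indep c l -> (forall z, z \in l -> img n z) -> (size l + n <= k)%N.
Proof.
move=> hk; have [|n hn hmin] := @least_nat inj_on_img.
  apply: NNPP => none.
  (* If injectivity failed at every level, the empty family at level [k.+1] would violate the
     bound. *)
  suff : (0 + k.+1 <= k)%N by rewrite ltnn.
  by apply: (img_trdeg_bound hk _ (l := [::])) => // m _ hm; apply: none; exists m.
by exists n; split => //; apply: img_trdeg_bound.
Qed.

End Specialization.

(** * Substitution morphisms and representatives of fractions *)

HB.instance Definition _ n :=
  GRing.RMorphism.copy (@ratfun_of n) (@FracField.tofrac _).
HB.instance Definition _ n :=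
  GRing.RMorphism.copy (@ratfun_const n) (@ratfun_of n \o @mpolyC n _).
HB.instance Definition _ l n (v : 'I_l -> ratfun n) :=
  GRing.RMorphism.copy (@poly_subst l n v) (mmap (@ratfun_const n) v).

Lemma ratfun_of_eq0 n (p : ratpoly n) : (ratfun_of p == 0) = (p == 0).
Proof. exact: tofrac_eq0. Qed.

Lemma ratfun_of_inj n : injective (@ratfun_of n).
Proof. by move=> p q /eqP; rewrite /ratfun_of tofrac_eq => /eqP. Qed.

Lemma poly_substC l n (v : 'I_l -> ratfun n) a : poly_subst v a%:MP = ratfun_const n a.
Proof. exact: mmapC. Qed.

Lemma poly_substX l n (v : 'I_l -> ratfun n) i : poly_subst v 'X_i = v i.
Proof. by rewrite /poly_subst mmapX mmap1U. Qed.

Lemma ratfunE n (x : ratfun n) :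
  x = ratfun_of \n_(repr x) / ratfun_of \d_(repr x).
Proof.
rewrite -{1}[x]reprK /ratfun_of; case: (repr x) => [[a b] /= b0] /=.
rewrite /GRing.inv /GRing.mul /= !piE; apply/eqmodP.
rewrite /= /FracField.equivf /FracField.mulf /FracField.invf.
by rewrite !numden_Ratio ?mul1r ?mulr1 ?oner_eq0 //= mulrC.
Qed.

Lemma ratfun_ind n (T : ratfun n -> Prop) :
  (forall p q, q != 0 -> T (ratfun_of p / ratfun_of q)) -> forall x, T x.
Proof. by move=> H x; rewrite [x]ratfunE; apply: H; apply: denom_ratioP. Qed.

(** * Partial derivatives of rational functions *)

(** The quotient rule on a chosen representative; [ratfun_derivE] shows that the choice does not
    matter. *)
Definition ratfun_deriv n (i : 'I_n) (x : ratfun n) : ratfun n :=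
  let p := \n_(repr x) in let q := \d_(repr x) in
  ratfun_of (p^`M(i) * q - p * q^`M(i)) / ratfun_of q ^+ 2.

Lemma ratfun_derivE n (i : 'I_n) p q : q != 0 ->
  ratfun_deriv i (ratfun_of p / ratfun_of q) =
  ratfun_of (p^`M(i) * q - p * q^`M(i)) / ratfun_of q ^+ 2.
Proof.
move=> q0; rewrite /ratfun_deriv.
set r := repr _; have d0 : \d_r != 0 := denom_ratioP r.
have /eqP : ratfun_of p / ratfun_of q = ratfun_of \n_r / ratfun_of \d_r.
  exact: ratfunE.
rewrite eqr_div ?ratfun_of_eq0 // -!rmorphM => /eqP /ratfun_of_inj.
move: (\n_r) (\d_r) d0 => a b b0 e.
have /eqP e' := congr1 (mderiv i) e; move: e'; rewrite !mderivM -subr_eq0 => /eqP e'.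
apply/eqP; rewrite eqr_div ?expf_neq0 ?ratfun_of_eq0 // -!rmorphXn -!rmorphM.
apply/eqP; congr ratfun_of; apply/eqP; rewrite -subr_eq0; apply/eqP.
move/eqP: e; rewrite -subr_eq0 => /eqP e.
move: e e'; set p' := mderiv i p; set q' := mderiv i q.
set a' := mderiv i a; set b' := mderiv i b => e e'.
(* The cross difference is a combination of the cross-multiplied equality [e] and its derivative
   [e']. *)
transitivity ((p * b - a * q) * (b' * q + q' * b) -
   (p' * b + p * b' - (a' * q + a * q')) * (b * q)); first by ring.
by rewrite e e' !mul0r subr0.
Qed.

Lemma ratfun_deriv_of n (i : 'I_n) p :
  ratfun_deriv i (ratfun_of p) = ratfun_of p^`M(i).
Proof.
have := ratfun_derivE i p (oner_neq0 _).
by rewrite rmorph1 expr1n !divr1 -mpolyC1 mderivC mulr0 subr0 mpolyC1 mulr1.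
Qed.

(** The vector field with components [a]: the derivation sending the variable x_i to [a i]. *)
Definition grad n (a : 'I_n -> ratfun n) (x : ratfun n) : ratfun n :=
  \sum_i a i * ratfun_deriv i x.

Lemma quotient_rule_add (F : fieldType) (p q p' q' r s r' s' : F) :
  q != 0 -> s != 0 ->
  ((p' * s + p * s' + (r' * q + r * q')) * (q * s) -
   (p * s + r * q) * (q' * s + q * s')) / (q * s) ^+ 2 =
  (p' * q - p * q') / q ^+ 2 + (r' * s - r * s') / s ^+ 2.
Proof. by move=> q0 s0; field; rewrite q0 s0. Qed.

Lemma quotient_rule_mul (F : fieldType) (p q p' q' r s r' s' : F) :
  q != 0 -> s != 0 ->
  ((p' * r + p * r') * (q * s) - (p * r) * (q' * s + q * s')) / (q * s) ^+ 2 =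
  (p' * q - p * q') / q ^+ 2 * (r / s) + p / q * ((r' * s - r * s') / s ^+ 2).
Proof. by move=> q0 s0; field; rewrite q0 s0. Qed.

Lemma ratfun_deriv_derivation n (i : 'I_n) : derivation (@ratfun_const n) (ratfun_deriv i).
Proof.
split=> [a|x y|x y].
- by rewrite /ratfun_const ratfun_deriv_of mderivC rmorph0.
- elim/ratfun_ind: x => p q q0; elim/ratfun_ind: y => p1 q1 q10.
  rewrite addf_div ?ratfun_of_eq0 // -!rmorphM -rmorphD !ratfun_derivE ?mulf_neq0 //.
  rewrite !mderivD !mderivM !(rmorphB, rmorphD, rmorphM) /=.
  by apply: quotient_rule_add; rewrite ratfun_of_eq0.
- elim/ratfun_ind: x => p q q0; elim/ratfun_ind: y => p1 q1 q10.
  rewrite mulf_div -!rmorphM !ratfun_derivE ?mulf_neq0 //.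
  rewrite !mderivM !(rmorphB, rmorphD, rmorphM) /=.
  by apply: quotient_rule_mul; rewrite ratfun_of_eq0.
Qed.

Lemma grad_derivation n (a : 'I_n -> ratfun n) : derivation (@ratfun_const n) (grad a).
Proof.
split=> [b|x y|x y]; rewrite /grad.
- by rewrite big1 // => i _; have [-> _ _] := ratfun_deriv_derivation i; rewrite mulr0.
- rewrite -big_split; apply: eq_bigr => i _; rewrite /= -mulrDr.
  by have [_ -> _] := ratfun_deriv_derivation i.
- rewrite mulr_suml mulr_sumr -big_split; apply: eq_bigr => i _.
  by have [_ _ ->] := ratfun_deriv_derivation i => /=; ring.
Qed.

Lemma grad_var n (a : 'I_n -> ratfun n) j : grad a (ratfun_var j) = a j.
Proof.
rewrite /grad /ratfun_var (bigD1 j) //= big1 => [|i ij];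
  rewrite ratfun_deriv_of mderivX mnmE ?eqxx ?(eq_sym j) ?(negPf ij) ?scale0r ?rmorph0 ?mulr0 //.
have -> : (U_(j) - U_(j))%MM = 0%MM :> 'X_{1..n} by apply/mnmP => i; rewrite mnmBE subnn mnm0E.
by rewrite scale1r mpolyX0 rmorph1 mulr1 addr0.
Qed.

(* A derivation killing [l] kills everything algebraic over [l], so by
   [transcendental_derivation] a variable [x_j] with [a j != 0] is transcendental
   over it. *)
Lemma exists_grad n (l : seq (ratfun n)) : (size l < n)%N ->
  exists a : 'I_n -> ratfun n,
    (forall z, z \in l -> grad a z = 0) /\ exists j, a j != 0.
Proof.
(* The Jacobian matrix has more rows than columns, so a nonzero row [a] annihilates it from the
   left. *)
move=> hl; pose M := \matrix_(i < n, j < size l) ratfun_deriv i l`_j.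
have : kermx M != 0.
  rewrite -mxrank_eq0 mxrank_ker subn_eq0 -ltnNge.
  exact: leq_ltn_trans (rank_leq_col M) hl.
case/rowV0Pn => a /sub_kermxP aM a0; exists (fun i => a 0 i); split.
  move=> z zl; have zi : (index z l < size l)%N by rewrite index_mem.
  have := congr1 (fun B : 'rV_(size l) => B 0 (Ordinal zi)) aM.
  rewrite !mxE => <-; apply: eq_bigr => i _.
  by rewrite mxE nth_index.
apply: NNPP => none; case/eqP: a0; apply/rowP => j; rewrite mxE.
by apply/eqP; apply: contra_notT none => aj; exists j.
Qed.

(** * Counting polynomials of bounded degree *)

Lemma msizeM_leS n (p q : ratpoly n) d e :
  (msize p <= d.+1)%N -> (msize q <= e.+1)%N -> (msize (p * q) <= (d + e).+1)%N.
Proof.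
have [->|p0] := eqVneq p 0; first by rewrite mul0r msize0.
have [->|q0] := eqVneq q 0; first by rewrite mulr0 msize0.
rewrite msizeM //; move: (msize p) (msize q) => a b; lia.
Qed.

Lemma msizeX_leS n (p : ratpoly n) d m :
  (msize p <= d.+1)%N -> (msize (p ^+ m) <= (m * d).+1)%N.
Proof.
move=> hp; elim: m => [|m IH]; first by rewrite expr0 msize1.
by rewrite exprS mulSn; apply: msizeM_leS.
Qed.

Lemma msize_prod_le n (I : Type) (r : seq I) (a : I -> ratpoly n) (d : I -> nat) :
  (forall i, (msize (a i) <= (d i).+1)%N) ->
  (msize (\prod_(i <- r) a i) <= (\sum_(i <- r) d i).+1)%N.
Proof.
move=> ha; elim/big_ind2: _ => // [|p e q e' h h']; first by rewrite msize1.
exact: msizeM_leS.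
Qed.

(** Exponents of a monomial of degree at most [e] are at most [e], so these monomials embed in a box
    of side [e.+1]. *)
Lemma card_bmultinom k e : (#|{: 'X_{1..k < e.+1}}| <= e.+1 ^ k)%N.
Proof.
pose f (m : 'X_{1..k < e.+1}) : {ffun 'I_k -> 'I_e.+1} := [ffun i => inord (bmnm m i)].
have f_inj : injective f.
  move=> m1 m2 /ffunP fe; apply/eqP; rewrite bmeqP; apply/eqP/mnmP => i.
  have hb (m : 'X_{1..k < e.+1}) : (bmnm m i < e.+1)%N.
    apply: leq_ltn_trans (bmdeg m); rewrite mdegE (bigD1 i) //=; exact: leq_addr.
  by have := congr1 val (fe i); rewrite !ffunE /= !inordK.
by have := leq_card f f_inj; rewrite card_ffun !card_ord.
Qed.

(** Independence makes the coefficient matrix row free, and its columns are indexed by the monomials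
    of degree at most [e]. *)
Lemma free_poly_bound k e (I : finType) (a : I -> ratpoly k) :
  (forall i, (msize (a i) <= e.+1)%N) ->
  (forall t : I -> rat, \sum_i t i *: a i = 0 -> forall i, t i = 0) ->
  (#|I| <= e.+1 ^ k)%N.
Proof.
move=> ha hfree; apply: leq_trans (card_bmultinom k e).
pose J := {: 'X_{1..k < e.+1}}.
pose M := \matrix_(i < #|I|, j < #|J|) (a (enum_val i))@_(bmnm (enum_val j)).
suff : row_free M by move/eqP=> <-; exact: rank_leq_col.
rewrite -kermx_eq0; apply: contraT => /rowV0Pn [t /sub_kermxP tM /eqP t0].
case: t0; apply/rowP => i; rewrite mxE.
rewrite -[i]enum_valK; apply: (hfree (fun i => t 0 (enum_rank i))).
apply/mpolyP => m; rewrite mcoeff0 raddf_sum /=.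
have [hm|hm] := ltnP (mdeg m) e.+1; last first.
  rewrite big1 // => j _; rewrite mcoeffZ (memN_msupp_eq0 (p := a j)) ?mulr0 //.
  by apply: msize_mdeg_ge; apply: leq_trans (ha j) hm.
have := congr1 (fun B : 'rV_#|J| => B 0 (enum_rank (BMultinom hm))) tM.
rewrite !mxE => tm0; rewrite -[RHS]tm0 (reindex (fun j : 'I_#|I| => enum_val j)) /=.
  by apply: eq_bigr => j _; rewrite mcoeffZ enum_valK !mxE enum_rankK.
by apply: onW_bij; exact: enum_val_bij.
Qed.

Lemma leq_expl e m n : (m <= n)%N -> (m ^ e <= n ^ e)%N.
Proof. by case: e => // e mn; rewrite leq_exp2r. Qed.

(** * Linearly independent families in a finitely generated subring *)

Section Room.
Variable k : nat.
Local Notation K := (ratfun k).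
Local Notation c := (@ratfun_const k).

Definition height_le (z : K) (d : nat) : Prop := exists (a b : ratpoly k),
  [/\ b != 0, (msize a <= d.+1)%N, (msize b <= d.+1)%N & z * ratfun_of b = ratfun_of a].

(* Q[s] contains [n] linearly independent elements with a common denominator and
   numerators of degree at most [e]. *)
Definition room (s : seq K) (n e : nat) : Prop :=
  exists (I : finType) (v : I -> K) (a : I -> ratpoly k) (b : ratpoly k),
  [/\ #|I| = n, b != 0 & forall i, (msize (a i) <= e.+1)%N] /\
  [/\ forall i, v i * ratfun_of b = ratfun_of (a i), forall i, adj c s (v i)
    & forall t : I -> rat, \sum_i c (t i) * v i = 0 -> forall i, t i = 0].

Lemma height_le_exists z : exists d, height_le z d.
Proof.
elim/ratfun_ind: z => p q q0.
exists (maxn (msize p) (msize q)), p, q; rewrite divfK ?ratfun_of_eq0 //.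
by split => //; lia.
Qed.

Lemma height_leW z d e : (d <= e)%N -> height_le z d -> height_le z e.
Proof. by move=> de [a [b [b0 ha hb E]]]; exists a, b; split => //; lia. Qed.

Lemma room_bound s n e : room s n e -> (n <= e.+1 ^ k)%N.
Proof.
move=> [I [v [a [b [[<- b0 ha] [E _ hfree]]]]]].
apply: (free_poly_bound ha) => t ta; apply: hfree.
have b0' : ratfun_of b != 0 by rewrite ratfun_of_eq0.
apply: (mulIf b0'); rewrite mul0r mulr_suml -[RHS](rmorph0 (@ratfun_of k)) -ta rmorph_sum.
by apply: eq_bigr => i _; rewrite -mulrA E -mul_mpolyC rmorphM.
Qed.

Lemma room_nil : room [::] 1 0.
Proof.
exists unit, (fun=> 1), (fun=> 1), 1; split; split.
- exact: card_unit.
- exact: oner_neq0.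
- by move=> _; rewrite msize1.
- by move=> _; rewrite mul1r.
- by move=> _; exists 1; rewrite rmorph1.
- move=> t; rewrite (bigD1 tt) //= big1 => [|[] //].
  by rewrite mulr1 addr0 => /eqP; rewrite fmorph_eq0 => /eqP tt0 [].
Qed.

Lemma room_cons s n e z d m : room s n e -> height_le z d ->
  (forall p : {poly K}, (forall i, adj c s p`_i) -> (size p <= m)%N ->
     p.[z] = 0 -> p = 0) ->
  room (z :: s) (n * m) (e + m * d).
Proof.
move=> [I [v [a [b [[cardI b0 ha] [E hv hfree]]]]]] [az [bz [bz0 haz hbz Ez]]] hz.
exists (I * 'I_m)%type, (fun x : I * 'I_m => v x.1 * z ^+ x.2),
  (* Over the denominator [bz ^+ m], the power [z ^+ j] has numerator [az ^+ j * bz ^+ (m - j)], of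
     degree at most [m * d]. *)
  (fun x : I * 'I_m => a x.1 * (az ^+ x.2 * bz ^+ (m - x.2))), (b * bz ^+ m).
split; split.
- by rewrite card_prod card_ord cardI.
- by rewrite mulf_neq0 // expf_neq0.
- move=> [i j] /=; apply: msizeM_leS; first exact: ha.
  have := msizeM_leS (msizeX_leS j haz) (msizeX_leS (m - j) hbz).
  by rewrite -mulnDl subnKC // ltnW.
- move=> [i j] /=; rewrite !rmorphM !rmorphXn /= -E -Ez.
  have -> : ratfun_of bz ^+ m = ratfun_of bz ^+ j * ratfun_of bz ^+ (m - j).
    by rewrite -exprD subnKC // ltnW.
  by rewrite exprMn mulrACA -!mulrA; congr (_ * _); rewrite mulrCA.
- move=> [i j]; change (adj c (z :: s) (v i * z ^+ j)); apply: adjM; first exact: adj_behead.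
  by apply: adjX; apply: adj_head.
- move=> t t0 [i j].
  (* The relation, regrouped by powers of [z], is a polynomial over Q[s] of size at most [m];
     [insub] turns the natural index into an ordinal. *)
  pose p := \poly_(l < m) \sum_i if insub l is Some j then c (t (i, j)) * v i else 0.
  have pc (l : 'I_m) : p`_l = \sum_i c (t (i, l)) * v i.
    by rewrite coef_poly ltn_ord; apply: eq_bigr => i' _; rewrite valK.
  have p0 : p = 0.
    apply: hz => [l||].
    - rewrite coef_poly; case: ltnP => hl; last exact: adj0.
      rewrite insubT; elim/big_ind: _ => [|x y|i' _]; first exact: adj0.
        exact: adjD.
      by apply: adjM => //; apply: adj_cst.
    - exact: size_poly.
    - rewrite (horner_coef_wide _ (size_poly _ _)) -[RHS]t0.
      under eq_bigr => l _ do rewrite pc mulr_suml.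
      rewrite exchange_big pair_bigA /=.
      by apply: eq_bigr => -[i' l] _ /=; rewrite mulrA.
  have := pc j; rewrite p0 coef0 => /esym pj.
  exact: (hfree (fun i => t (i, j)) pj i).
Qed.

Lemma room_indep s d N : indep c s -> (forall z, z \in s -> height_le z d) ->
  room s (N ^ size s) (size s * (N * d)).
Proof.
elim: s => [|z s IH] /=; first by move=> _ _; rewrite mul0n; exact: room_nil.
move=> [ids tz] hs; rewrite expnSr mulSn addnC; apply: room_cons.
- by apply: IH => // y ys; apply: hs; rewrite inE ys orbT.
- by apply: hs; rewrite inE eqxx.
- by move=> p hp _; apply: tz.
Qed.

Lemma height_le_seq (s : seq K) : exists d, forall z, z \in s -> height_le z d.
Proof.
elim: s => [|z s [d hd]]; first by exists 0%N.
have [e he] := height_le_exists z.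
exists (maxn d e) => y; rewrite inE => /orP[/eqP ->|/hd].
  by apply: height_leW he; apply: leq_maxr.
by apply: height_leW; apply: leq_maxl.
Qed.

Lemma indep_size s : indep c s -> (size s <= k)%N.
Proof.
move=> ids; have [d hd] := height_le_seq s.
(* Since [N] exceeds [X ^ k], the power [N ^ k.+1] exceeds [(X * N) ^ k], which rules out
   [r > k]. *)
set r := size s; pose X := (r * d).+1; pose N := (X ^ k).+1.
have h : (N ^ r <= (X * N) ^ k)%N.
  apply: leq_trans (room_bound (room_indep N ids hd)) _.
  by apply: leq_expl; rewrite /X mulSn; lia.
rewrite leqNgt; apply/negP => kr.
have : (N ^ k.+1 <= (X * N) ^ k)%N.
  by apply: leq_trans h; rewrite leq_pexp2l.
by rewrite expnS expnMn leq_mul2r ltnn orbF expn_eq0.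
Qed.

End Room.

(** * Comparison of leading coefficients *)

Lemma expn_affine_le k X C :
  exists E, forall N, (0 < N)%N -> ((X * N + C) ^ k.+1 <= X ^ k.+1 * N ^ k.+1 + E * N ^ k)%N.
Proof.
elim: k => [|k [E hE]]; first by exists C => N _; rewrite !expn1 expn0 muln1.
exists (X * E + C * X ^ k.+1 + C * E)%N => N N0.
rewrite expnS; apply: leq_trans (leq_mul (leqnn _) (hE N N0)) _.
rewrite (expnS X k.+1) (expnS N k.+1) (expnS N k).
have : (C * (E * N ^ k) <= C * (E * (N * N ^ k)))%N.
  by rewrite !leq_mul2l leq_pmull // !orbT.
by lia.
Qed.

Lemma expn_affine_bound k a X C : (0 < k)%N ->
  (forall N, (0 < N)%N -> (a * N ^ k <= (X * N + C) ^ k)%N) -> (a <= X ^ k)%N.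
Proof.
case: k => // k _ h; have [E hE] := expn_affine_le k X C.
rewrite leqNgt; apply/negP => ha.
(* If [a > X ^ k.+1], the two bounds force [N <= E], which fails at [N = E.+1]. *)
have := leq_trans (h E.+1 isT) (hE E.+1 isT).
have : ((X ^ k.+1).+1 * E.+1 ^ k.+1 <= a * E.+1 ^ k.+1)%N by rewrite leq_mul2r ha orbT.
have : (0 < E.+1 ^ k)%N by rewrite expn_gt0.
rewrite mulSn (expnS E.+1 k); nia.
Qed.

(** * A rational relation along an orbit *)

(** The latest term comes first, so that each term is adjoined to its predecessors, as [indep]
    requires. *)
Fixpoint initial (T : Type) (g : nat -> T) (n : nat) : seq T :=
  if n is n'.+1 then g n' :: initial g n' else [::].

Lemma size_initial T (g : nat -> T) n : size (initial g n) = n.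
Proof. by elim: n => //= n ->. Qed.

Lemma initialP (T : eqType) (g : nat -> T) n z :
  z \in initial g n -> exists2 i, (i < n)%N & z = g i.
Proof.
elim: n => // n IH; rewrite inE => /orP[/eqP ->|/IH [i hi ->]]; first by exists n.
by exists i => //; apply: leqW.
Qed.

Lemma mem_initial (T : eqType) (g : nat -> T) n i : (i < n)%N -> g i \in initial g n.
Proof.
elim: n => // n IH; rewrite ltnS leq_eqVlt inE => /orP[/eqP ->|/IH ->].
  by rewrite eqxx.
by rewrite orbT.
Qed.

(** This places [g n] in the field generated by the earlier terms. The denominator is cleared so
    that [theta] can be applied to the identity. *)
Definition rational_relation (K : fieldType) (c : {rmorphism rat -> K})
    (g : nat -> K) (n : nat) : Prop :=
  exists x y, [/\ adj c (initial g n) x, adj c (initial g n) y, y != 0 & x + y * g n = 0].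

(** A nonzero linear coefficient would give a rational relation. The conclusion is the hypothesis of
    [room_cons] for [m = 2], the source of each factor 2. *)
Lemma free2_of_no_relation (K : fieldType) (c : {rmorphism rat -> K}) g n :
  ~ rational_relation c g n ->
  forall p : {poly K}, (forall i, adj c (initial g n) p`_i) -> (size p <= 2)%N ->
  p.[g n] = 0 -> p = 0.
Proof.
move=> norel p hp sp; rewrite (horner_coef_wide _ sp) !big_ord_recl big_ord0 /=.
rewrite /bump /= expr0 mulr1 addr0 expr1 => pg.
have p1 : p`_1 = 0.
  by apply/eqP; apply: contra_notT norel => p1; exists p`_0, p`_1.
move: pg; rewrite p1 mul0r addr0 => p0.
apply/polyP => -[|[|i]]; rewrite coef0 //.
by rewrite nth_default //; apply: leq_trans sp _.
Qed.

Section Orbit.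
Variable k : nat.
Local Notation K := (ratfun k).
Local Notation c := (@ratfun_const k).
Variables (A : K -> Prop) (theta : K -> K) (f : nat -> K) (q : nat).
Hypothesis k_gt0 : (0 < k)%N.
Hypothesis q_gt0 : (0 < q)%N.
Hypothesis A_cst : forall a, A (c a).
Hypothesis A_add : forall x y, A x -> A y -> A (x + y).
Hypothesis A_mul : forall x y, A x -> A y -> A (x * y).
Hypothesis theta_hom : hom_on c A theta.
Hypothesis theta_A : forall x, A x -> A (theta x).
Hypothesis f0_A : A (f 0%N).
Hypothesis fS : forall n, f n.+1 = theta (f n).
Hypothesis f_height : forall n, height_le (f n) (q ^ n).

Lemma f_iter n j : f (n + j) = iter n theta (f j).
Proof. by elim: n => //= n <-; rewrite addSn fS. Qed.

Variable S : nat.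
Hypothesis S_inj : inj_on_img A theta S.
Let g i := f (S + i).

Lemma g_img i : img A theta S (g i).
Proof.
exists (f i); last exact: f_iter.
by rewrite -[i]addn0 f_iter; apply: iter_A.
Qed.

Lemma g_iter n j : iter n theta (g j) = g (n + j).
Proof. by rewrite /g -f_iter addnCA. Qed.

Lemma adj_initial_img n x : adj c (initial g n) x -> img A theta S x.
Proof.
have [h1 h2 h3] := img_ring A_cst A_add A_mul theta_hom theta_A S.
by apply: adj_ind => // z /initialP [i _ ->]; apply: g_img.
Qed.

Lemma map_iter_initial n d :
  map (iter n theta) (initial g d) = initial (fun i => g (n + i)) d.
Proof. by elim: d => //= d ->; rewrite g_iter. Qed.

Lemma derivation_adj D s x : derivation c D -> (forall z, z \in s -> D z = 0) ->
  adj c s x -> D x = 0.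
Proof.
move=> [Dc DD DM] Ds.
apply: (adj_ind (T := fun x => D x = 0)) => // y z hy hz.
  by rewrite DD hy hz addr0.
by rewrite DM hy hz mul0r mulr0 addr0.
Qed.

(* Shifting the algebraic equation of [g d] by [theta] shows that all later
   terms are algebraic over the initial ones, with no loss since [theta] is
   injective on [img A theta S]. *)
Lemma derivation_orbit D d (p : {poly K}) : derivation c D ->
  (forall i, adj c (initial g d) p`_i) -> p != 0 -> p.[g d] = 0 ->
  (forall i, (i < d)%N -> D (g i) = 0) -> forall i, D (g i) = 0.
Proof.
move=> hD hp p0 pg Dg i; have [m] := ubnP i; elim: m i => // m IH i im.
have [/Dg //|di] := ltnP i d.
set h := iter (i - d) theta.
have hh : hom_on c A h by apply: iter_hom.
have gA j : A (g j) by apply: img_A (g_img j).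
have Ap j : A p`_j by apply: img_A (adj_initial_img (hp j)).
apply/eqP; apply: contraT => Dgi; case/eqP: p0.
have hq : map_poly h p = 0.
  apply: (transcendental_derivation hD Dgi) => [j|].
    rewrite coef_map_id0 ?(hom0 hh) //.
    have := adj_hom A_cst A_add A_mul hh (l := initial g d) _ (hp j).
    rewrite map_iter_initial => hj; apply: (derivation_adj hD) (hj _) => z /initialP [a ad ->].
      by apply: IH; lia.
    exact: gA.
  rewrite -[g i](_ : h (g d) = _); last by rewrite /h g_iter subnK.
  by rewrite -(hom_horner A_cst A_add A_mul hh Ap (gA d)) pg (hom0 hh).
apply/polyP => j; rewrite coef0; apply: (img_iter_inj theta_A (j := i - d) S_inj).
  exact: adj_initial_img (hp j).
by have := congr1 (fun r : {poly K} => r`_j) hq; rewrite coef_map_id0 ?(hom0 hh) // coef0.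
Qed.

Lemma height_le_var (j : 'I_k) d : (0 < d)%N -> height_le (ratfun_var j) d.
Proof.
move=> d0; exists 'X_j, 1; rewrite oner_neq0 msize1 msizeX mdeg1 rmorph1 mulr1.
by split.
Qed.

(* The indices [d <= i < d + L] contribute a factor [2] each, and [g 0, ...,
   g (d - 1)] together with [k - d] variables form a transcendence basis. *)
Lemma two_pow_bound d L (p : {poly K}) :
  indep c (initial g d) -> (d + S <= k)%N ->
  (forall i, adj c (initial g d) p`_i) -> p != 0 -> p.[g d] = 0 ->
  (forall i, (i < L)%N -> ~ rational_relation c g (d + i)) ->
  (2 ^ L <= (k * q ^ k) ^ k)%N.
Proof.
move=> ind dS hp p0 pg norel.
have g_height i e : (S + i <= e)%N -> height_le (g i) (q ^ e).
  by move=> ie; apply: height_leW (f_height _); apply: leq_pexp2l.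
have dk : (d <= k)%N by lia.
have mulSn_add a b m : (a + m.+1 * b = a + m * b + b)%N by rewrite mulSn addnCA addnC.
(* [C] does not depend on [N], so it cannot affect the leading coefficient; the extra 1 in [C.+1] is
   the one in [room_bound]. *)
pose C := (L * (2 * q ^ (S + d + L)))%N.
apply: (expn_affine_bound (C := C.+1) k_gt0) => N N0.
(* For [i < d], [dS] gives [S + i <= k], so these terms have height at most [q ^ k]. *)
have r1 : room (initial g d) (N ^ d) (d * (N * q ^ k)).
  rewrite -{2 3}(size_initial g d); apply: room_indep => // z /initialP [i id ->].
  by apply: g_height; lia.
have r2 l : (l <= L)%N -> room (initial g (d + l)) (N ^ d * 2 ^ l)
    (d * (N * q ^ k) + l * (2 * q ^ (S + d + L))).
  elim: l => [|l IH] lL; first by rewrite addn0 expn0 muln1 mul0n addn0.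
  rewrite addnS expnSr mulnA mulSn_add.
  apply: room_cons; first by apply: IH; lia.
    by apply: g_height; lia.
  by apply: free2_of_no_relation; apply: norel.
(* [bs] is the part of the transcendence basis built so far; the last clause expresses, through
   derivations, that [s] depends algebraically on it. *)
have r3 j : (j <= k - d)%N -> exists s bs : seq K,
    [/\ room s (N ^ d * 2 ^ L * N ^ j) (d * (N * q ^ k) + C + j * (N * q ^ k)),
      size bs = (d + j)%N & forall a : 'I_k -> K, (forall z, z \in bs -> grad a z = 0) ->
        forall z, z \in s -> grad a z = 0].
  elim: j => [|j IH] jk.
    exists (initial g (d + L)), (initial g d).
    rewrite expn0 muln1 mul0n !addn0 size_initial; split => //; first exact: r2.
    move=> a ha z /initialP [i _ ->].
    apply: (derivation_orbit (grad_derivation a) hp p0 pg) => i' id.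
    by apply: ha; apply: mem_initial.
  have [|s [bs [hr hbs hD]]] := IH; first by lia.
  (* As [bs] has fewer than [k] entries, some derivation kills [bs], hence [s], but not the variable
     x_j0, which is therefore transcendental over Q[s]. *)
  have [|a [ha [j0 aj0]]] := @exists_grad _ bs; first by rewrite hbs; lia.
  exists (ratfun_var j0 :: s), (ratfun_var j0 :: bs); split.
  - rewrite expnSr mulnA mulSn_add.
    apply: (room_cons hr); first by apply: height_le_var; rewrite expn_gt0 q_gt0.
    move=> r hr' _; apply: (transcendental_derivation (grad_derivation a)).
      by rewrite grad_var.
    move=> i; apply: (derivation_adj (grad_derivation a)) (hr' i).
    exact: hD.
  - by rewrite /= hbs addnS.
  - move=> b hb z; rewrite inE => /orP[/eqP ->|].
      by apply: hb; rewrite inE eqxx.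
    by apply: hD => y hy; apply: hb; rewrite inE hy orbT.
have [s [bs [hr _ _]]] := r3 _ (leqnn _).
have := room_bound hr; rewrite mulnAC -expnD subnKC // mulnC => /leq_trans; apply.
apply: leq_expl.
have -> : (k * q ^ k * N = d * (N * q ^ k) + (k - d) * (N * q ^ k))%N.
  by rewrite -mulnDl subnKC // mulnAC mulnA.
lia.
Qed.

End Orbit.

Lemma orbit_relation k (A : ratfun k -> Prop) (theta : ratfun k -> ratfun k)
    (f : nat -> ratfun k) (q : nat) :
  (0 < k)%N -> (0 < q)%N -> (forall a, A (ratfun_const k a)) ->
  (forall x y, A x -> A y -> A (x + y)) ->
  (forall x y, A x -> A y -> A (x * y)) ->
  hom_on (@ratfun_const k) A theta -> (forall x, A x -> A (theta x)) ->
  A (f 0%N) -> (forall n, f n.+1 = theta (f n)) ->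
  (forall n, height_le (f n) (q ^ n)) ->
  exists S M L, [/\ (S + M <= k + L)%N, (2 ^ L <= (k * q ^ k) ^ k)%N,
    inj_on_img A theta S & rational_relation (@ratfun_const k) (fun i => f (S + i)) M].
Proof.
move=> k0 q0 Ac AD AM th tA f0A fS fh.
have [S [S_inj hS]] := exists_inj_on_img Ac AD AM th tA (@indep_size k).
pose g i := f (S + i).
pose c : {rmorphism rat -> ratfun k} := @ratfun_const k.
pose alg d := ~ transcendental (adj c (initial g d)) (g d).
have indg n : (forall i, (i < n)%N -> ~ alg i) -> indep c (initial g n).
  elim: n => // n IH hn; split; first by apply: IH => i hi; apply: hn; apply: leqW.
  by apply: NNPP; apply: hn.
have g_im i := g_img tA f0A fS S i.
(* Otherwise the first [k.+1] terms would be independent, against [indep_size]. *)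
have [|d alg_d hd] := @least_nat alg.
  apply: NNPP => none; have /indep_size : indep c (initial g k.+1).
    by apply: indg => i _ hi; apply: none; exists i.
  by rewrite size_initial ltnn.
have ind := indg d hd.
have dS : (d + S <= k)%N.
  by have := hS _ ind; rewrite size_initial; apply => z /initialP [i _ ->]; apply: g_im.
have [p [hp [pg /eqP p0]]] : exists p : {poly (ratfun k)},
    (forall i, adj c (initial g d) p`_i) /\ p.[g d] = 0 /\ p <> 0.
  apply: NNPP => none; apply: alg_d => p hp pg.
  by apply: NNPP => p0; apply: none; exists p.
have bound L := two_pow_bound k0 q0 Ac AD AM th tA f0A fS fh S_inj (L := L) ind dS hp p0 pg.
(* Otherwise [bound] would apply to every [L], in particular to [L] equal to its own right-hand
   side. *)
have [|L relL hL] := @least_nat (fun L => rational_relation c g (d + L)).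
  apply: NNPP => none.
  have := bound ((k * q ^ k) ^ k)%N (fun i _ hi => none (ex_intro _ i hi)).
  by rewrite leqNgt ltn_expl.
exists S, (d + L)%N, L; split => //; first by lia.
exact: bound.
Qed.

(** * Polynomials in several variables *)

Lemma mpoly_ring_ind n (T : ratpoly n -> Prop) :
  (forall a, T a%:MP) -> (forall p q, T p -> T q -> T (p + q)) ->
  (forall p q, T p -> T q -> T (p * q)) -> (forall i, T 'X_i) -> forall p, T p.
Proof.
move=> Tc TD TM TX; apply: mpolyind; first by rewrite -mpolyC0; apply: Tc.
move=> a m p _ _ hp; apply: TD => //; rewrite -mul_mpolyC; apply: (TM) => //.
have T1 : T 1 by rewrite -mpolyC1; apply: Tc.
rewrite mpolyXE_id; apply: (big_ind T T1 TM) => i _.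
by elim: (m i) => [|j IH]; [rewrite expr0 | rewrite exprS; apply: TM].
Qed.

Lemma msize_unit n (p : ratpoly n) : msize p = 1%N -> p \is a GRing.unit.
Proof.
move=> /eqP /msize_poly1P [a a0 ->]; apply: rmorph_unit.
by rewrite unitfE.
Qed.

(** A nonunit common divisor is nonconstant, so dividing by it lowers the degree of the
    denominator. *)
Lemma coprime_reduction n (p q : ratpoly n) : q != 0 -> exists p' q' r,
  [/\ q' != 0, poly_coprime p' q', p = p' * r & q = q' * r].
Proof.
have [m] := ubnP (msize q); elim: m p q => // m IH p q hm q0.
have [|notcop] := classic (poly_coprime p q); first by exists p, q, 1; rewrite !mulr1.
have [d [[p1 p_def] [[q1 q_def] nu]]] : exists d,
    poly_divides d p /\ poly_divides d q /\ ~ d \is a GRing.unit.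
  apply: NNPP => none; apply: notcop => d dp dq; apply: NNPP => nu.
  by apply: none; exists d.
have /andP [q10 d0] : (q1 != 0) && (d != 0).
  by rewrite -negb_or -mulf_eq0 -q_def.
have d1 : (1 < msize d)%N.
  rewrite ltn_neqAle lt0n msize_poly_eq0 d0 andbT; apply/eqP => /esym d1.
  by apply: nu; apply: msize_unit.
have [|p' [q' [r [q'0 cop p1_def q1_def]]]] := IH p1 q1 _ q10.
  by move: hm; rewrite q_def msizeM //; move: (msize d) (msize q1) d1 => a b; lia.
by exists p', q', (r * d); rewrite !mulrA -p1_def -q1_def.
Qed.

(** * The orbit and its substitution endomorphism *)

Section Dynamics.
Variables (k D : nat) (num den : 'I_k -> ratpoly k) (F : nat -> 'I_k -> ratfun k).
Local Notation K := (ratfun k).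
Local Notation c := (@ratfun_const k).
Hypothesis hF0 : forall i, F 0%N i = ratfun_var i.
Hypothesis hwd : forall n i, poly_subst (F n) (den i) != 0.
Hypothesis hFS : forall n i,
  F n.+1 i = poly_subst (F n) (num i) / poly_subst (F n) (den i).

Definition good_frac (p q : ratpoly k) (x : K) : Prop :=
  (forall n, poly_subst (F n) q != 0) /\ x = ratfun_of p / ratfun_of q.

Definition regular (x : K) : Prop := exists p q, good_frac p q x.

(** Evaluation at [F n] through some admissible representative, irrelevant which by [orbit_valueE];
    unspecified outside [regular]. *)
Definition orbit_value (n : nat) (x : K) : K :=
  epsilon (inhabits 0) (fun y => exists p q,
    good_frac p q x /\ y = poly_subst (F n) p / poly_subst (F n) q).

Lemma good_frac_neq0 p q x : good_frac p q x -> q != 0.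
Proof. by move=> [hq _]; apply: contraNneq (hq 0%N) => ->; rewrite rmorph0. Qed.

Lemma orbit_valueE n p q x : good_frac p q x ->
  orbit_value n x = poly_subst (F n) p / poly_subst (F n) q.
Proof.
move=> hpq; rewrite /orbit_value.
have [|p1 [q1 [hpq1 ->]]] := epsilon_spec (inhabits 0) (fun y => exists p q,
    good_frac p q x /\ y = poly_subst (F n) p / poly_subst (F n) q).
  by exists (poly_subst (F n) p / poly_subst (F n) q), p, q.
have q0 := good_frac_neq0 hpq; have q10 := good_frac_neq0 hpq1.
case: hpq hpq1 => [hq ->] [hq1 /eqP].
rewrite eqr_div ?ratfun_of_eq0 // -!rmorphM => /eqP /ratfun_of_inj e.
by apply/eqP; rewrite eqr_div // -!rmorphM e.
Qed.

Lemma good_frac_cst a : good_frac a%:MP 1 (c a).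
Proof. by split => [n|]; rewrite ?rmorph1 ?oner_neq0 ?divr1. Qed.

Lemma good_frac_add p q p1 q1 x y : good_frac p q x -> good_frac p1 q1 y ->
  good_frac (p * q1 + p1 * q) (q * q1) (x + y).
Proof.
move=> h h1; have q0 := good_frac_neq0 h; have q10 := good_frac_neq0 h1.
case: h h1 => [hq ->] [hq1 ->]; split => [n|]; first by rewrite rmorphM mulf_neq0 ?hq ?hq1.
by rewrite addf_div ?ratfun_of_eq0 // !(rmorphD, rmorphM).
Qed.

Lemma good_frac_mul p q p1 q1 x y : good_frac p q x -> good_frac p1 q1 y ->
  good_frac (p * p1) (q * q1) (x * y).
Proof.
case=> [hq ->] [hq1 ->]; split => [n|]; first by rewrite rmorphM mulf_neq0 ?hq ?hq1.
by rewrite mulf_div !rmorphM.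
Qed.

Lemma regular_cst a : regular (c a).
Proof. by exists a%:MP, 1; apply: good_frac_cst. Qed.

Lemma regularD x y : regular x -> regular y -> regular (x + y).
Proof.
move=> [p [q h]] [p1 [q1 h1]]; exists (p * q1 + p1 * q), (q * q1).
exact: good_frac_add.
Qed.

Lemma regularM x y : regular x -> regular y -> regular (x * y).
Proof.
by move=> [p [q h]] [p1 [q1 h1]]; exists (p * p1), (q * q1); apply: good_frac_mul.
Qed.

Lemma orbit_value_hom n : hom_on c regular (orbit_value n).
Proof.
split=> [a|x y [p [q h]] [p1 [q1 h1]]|x y [p [q h]] [p1 [q1 h1]]].
- by rewrite (orbit_valueE n (good_frac_cst a)) poly_substC rmorph1 divr1.
- rewrite (orbit_valueE n (good_frac_add h h1)) (orbit_valueE n h) (orbit_valueE n h1).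
  by rewrite addf_div ?(proj1 h) ?(proj1 h1) // rmorphD !rmorphM.
- rewrite (orbit_valueE n (good_frac_mul h h1)) (orbit_valueE n h) (orbit_valueE n h1).
  by rewrite mulf_div !rmorphM.
Qed.

Lemma regular_div x y : regular x -> regular y -> (forall n, orbit_value n y != 0) ->
  regular (x / y) /\
  forall n, orbit_value n (x / y) = orbit_value n x / orbit_value n y.
Proof.
move=> hx [p [q h]] hy0.
have hinv : good_frac q p y^-1.
  case: (h) => [hq y_def]; split => [n|]; last by rewrite y_def invf_div.
  by apply: contraNneq (hy0 n); rewrite (orbit_valueE n h) => ->; rewrite mul0r.
have ry : regular y^-1 by exists q, p.
split; first exact: regularM.
move=> n; have [_ _ ->] := orbit_value_hom n => //.
by rewrite (orbit_valueE n hinv) (orbit_valueE n h) invf_div.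
Qed.

Lemma regular_subst l (v : 'I_l -> K) (w : nat -> 'I_l -> K) :
  (forall i, regular (v i)) -> (forall n i, orbit_value n (v i) = w n i) ->
  forall p, regular (poly_subst v p) /\
    forall n, orbit_value n (poly_subst v p) = poly_subst (w n) p.
Proof.
move=> hv hw; apply: mpoly_ring_ind.
- move=> a; rewrite poly_substC; split; first exact: regular_cst.
  by move=> n; have [-> _ _] := orbit_value_hom n; rewrite poly_substC.
- move=> p q [rp ep] [rq eq]; rewrite rmorphD; split; first exact: regularD.
  by move=> n; have [_ -> // _] := orbit_value_hom n; rewrite ep eq rmorphD.
- move=> p q [rp ep] [rq eq]; rewrite rmorphM; split; first exact: regularM.
  by move=> n; have [_ _ ->] := orbit_value_hom n => //; rewrite ep eq rmorphM.
- by move=> i; rewrite poly_substX; split => // n; rewrite poly_substX.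
Qed.

(** Substitution adds the times. Both claims share one induction: the denominators of [F j.+1] take
    at [F n] the values of [den] at [F (n + j)], nonzero by [hwd]. *)
Lemma regular_orbit j : (forall i, regular (F j i)) /\
  forall n i, orbit_value n (F j i) = F (n + j)%N i.
Proof.
elim: j => [|j [rj ej]].
  have h i : good_frac 'X_i 1 (F 0%N i).
    by split => [n|]; rewrite ?hF0 rmorph1 ?oner_neq0 ?divr1.
  split=> [i|n i]; first by exists 'X_i, 1.
  by rewrite (orbit_valueE n (h i)) poly_substX rmorph1 divr1 addn0.
have hsub := regular_subst rj ej.
have hdiv i := regular_div (proj1 (hsub (num i))) (proj1 (hsub (den i))) _.
have den0 i n : orbit_value n (poly_subst (F j) (den i)) != 0.
  by rewrite (proj2 (hsub _)).
split=> [i|n i]; rewrite hFS; have [r e] := hdiv den0 i; first exact: r.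
by rewrite e !(proj2 (hsub _)) addnS hFS.
Qed.

(** The new denominator q(F_n) takes at F_m the value q(F_(m+n)), which is nonzero. *)
Lemma regular_orbit_value n x : regular x -> regular (orbit_value n x).
Proof.
move=> [p [q h]]; rewrite (orbit_valueE n h).
have [r e] := regular_orbit n.
have hsub := regular_subst r e.
apply: (proj1 (regular_div (proj1 (hsub p)) (proj1 (hsub q)) _)) => m.
by rewrite (proj2 (hsub q)) (proj1 h).
Qed.

Lemma orbit_shift n i : F n.+1 i = orbit_value 1 (F n i).
Proof. by have [_ ->] := regular_orbit n. Qed.

Hypothesis hdeg : forall i, (ratfun_degree (num i) (den i) <= D)%N.

(* Homogenizing [p] in degree [d] clears the common denominator [b]. *)
Lemma subst_common_denom (v : 'I_k -> K) (a : 'I_k -> ratpoly k) b e d (p : ratpoly k) :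
  (forall i, v i * ratfun_of b = ratfun_of (a i)) ->
  (forall i, (msize (a i) <= e.+1)%N) -> (msize b <= e.+1)%N -> (msize p <= d.+1)%N ->
  exists2 r, (msize r <= (d * e).+1)%N & poly_subst v p * ratfun_of b ^+ d = ratfun_of r.
Proof.
move=> va ha hb hp.
have md m : m \in msupp p -> (mdeg m <= d)%N.
  by move/msize_mdeg_lt => h; rewrite -ltnS; apply: leq_trans h hp.
exists (\sum_(m <- msupp p) p@_m *: (\prod_i a i ^+ m i * b ^+ (d - mdeg m))).
  rewrite big_seq; apply: (big_ind (fun r => msize r <= (d * e).+1)%N).
  - by rewrite msize0.
  - by move=> r s hr hs; apply: leq_trans (msizeD_le _ _) _; rewrite geq_max hr.
  - move=> m /md hm; apply: leq_trans (msizeZ_le _ _) _.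
    have := msizeM_leS (msize_prod_le (index_enum 'I_k) (fun i => msizeX_leS (m i) (ha i)))
      (msizeX_leS (d - mdeg m) hb).
    by rewrite -big_distrl -mdegE /= -mulnDl subnKC.
rewrite /poly_subst /mmap mulr_suml rmorph_sum !big_seq.
apply: eq_bigr => m /md hm.
rewrite -mul_mpolyC !rmorphM rmorph_prod rmorphXn /= -mulrA; congr (_ * _).
have -> : ratfun_of b ^+ d = ratfun_of b ^+ mdeg m * ratfun_of b ^+ (d - mdeg m).
  by rewrite -exprD subnKC.
rewrite mulrA; congr (_ * _); rewrite mdegE -prodrXr /mmap1 -big_split.
by apply: eq_bigr => i _; rewrite rmorphXn /= -va exprMn.
Qed.

Lemma orbit_common_denom n : exists (a : 'I_k -> ratpoly k) (b : ratpoly k),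
  [/\ b != 0, (msize b <= ((k * D) ^ n).+1)%N,
    forall i, (msize (a i) <= ((k * D) ^ n).+1)%N
    & forall i, F n i * ratfun_of b = ratfun_of (a i)].
Proof.
elim: n => [|n [a [b [b0 hb ha E]]]].
  exists (fun i => 'X_i), 1; rewrite oner_neq0 msize1; split => // i.
    by rewrite msizeX mdeg1.
  by rewrite hF0 rmorph1 mulr1.
set e := ((k * D) ^ n)%N in hb ha.
have hsz p : (total_degree p <= D)%N -> (msize p <= D.+1)%N.
  by rewrite /total_degree; case: (msize p).
have hnd i : exists rs, [/\ (msize rs.1 <= (D * e).+1)%N, (msize rs.2 <= (D * e).+1)%N,
    poly_subst (F n) (num i) * ratfun_of b ^+ D = ratfun_of rs.1
    & poly_subst (F n) (den i) * ratfun_of b ^+ D = ratfun_of rs.2].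
  move: (hdeg i); rewrite /ratfun_degree geq_max => /andP [/hsz hnum /hsz hden].
  have [r hr Er] := subst_common_denom E ha hb hnum.
  have [s hs Es] := subst_common_denom E ha hb hden.
  by exists (r, s).
have [rs hrs] := fin_all_exists hnd.
have bD0 : ratfun_of b ^+ D != 0 by rewrite expf_neq0 // ratfun_of_eq0.
have s0 i : (rs i).2 != 0.
  by have [_ _ _ Es] := hrs i; rewrite -ratfun_of_eq0 -Es (mulf_neq0 (hwd n i) bD0).
have deg_prod (x : 'I_k -> ratpoly k) : (forall i, (msize (x i) <= (D * e).+1)%N) ->
    (msize (\prod_i x i) <= ((k * D) ^ n.+1).+1)%N.
  move=> hx; have := msize_prod_le (index_enum 'I_k) hx.
  by rewrite sum_nat_const card_ord expnS mulnA.
(* The common denominator is a product of [k] factors of degree at most [D * e], whence the growth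
   factor [k * D]; the powers of [b] cancel. *)
exists (fun i => \prod_j (if j == i then (rs j).1 else (rs j).2)), (\prod_j (rs j).2).
split.
- by apply/prodf_neq0 => j _.
- by apply: deg_prod => i; have [] := hrs i.
- by move=> i; apply: deg_prod => j; have [h1 h2 _ _] := hrs j; case: eqP.
- move=> i; rewrite (bigD1 i) //= [in RHS](bigD1 i) //= eqxx !rmorphM /= mulrA.
  congr (_ * _); last first.
    by congr ratfun_of; apply: eq_bigr => j /negPf ->.
  have [_ _ Er Es] := hrs i.
  by rewrite -Er -Es hFS mulrA (divfK (hwd n i)).
Qed.

Lemma orbit_height n i : height_le (F n i) ((k * D) ^ n).
Proof.
by have [a [b [b0 hb ha E]]] := orbit_common_denom n; exists (a i), b; split.
Qed.

End Dynamics.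

(** * Numerical bounds and conclusion *)

Lemma expn_bound k q : (0 < k)%N -> (k <= q)%N -> ((k * q ^ k) ^ k <= q ^ (k ^ 3))%N.
Proof.
move=> k0 kq; have q0 : (0 < q)%N by apply: leq_trans kq.
have -> : (k ^ 3 = k ^ 2 * k)%N by rewrite -expnSr.
rewrite expnM; apply: leq_expl.
(* The case [k = 1] is separate: the estimate through [q ^ k.+1] needs [k.+1 <= k ^ 2]. *)
case: k k0 kq => [//|[|k]] _ kq; first by rewrite mul1n.
apply: (@leq_trans (q ^ k.+3)); first by rewrite [in leqRHS]expnS leq_mul2r kq orbT.
by rewrite leq_pexp2l //; nia.
Qed.

Lemma pow_le_log2 (L e q : nat) : (0 < q)%N -> (2 ^ L <= q ^ e)%N ->
  (INR L <= INR e * log2 (INR q))%coqR.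
Proof.
move=> q0 h.
have INRX a b : INR (a ^ b)%N = (INR a ^ b)%coqR.
  by elim: b => //= b IH; rewrite expnS mult_INR IH.
have ln2 : (0 < ln 2)%coqR by rewrite -ln_1; apply: ln_increasing; Lra.lra.
have hle : (2 ^ L <= INR q ^ e)%coqR.
  have -> : (2 = INR 2)%coqR by [].
  by rewrite -!INRX; apply: le_INR; apply/ssrnat.leP.
have q0' : (0 < INR q)%coqR by apply: lt_0_INR; apply/ssrnat.ltP.
have hln : (INR L * ln 2 <= INR e * ln (INR q))%coqR.
  rewrite -!ln_pow //; last by Lra.lra.
  case: hle => [hlt | ->]; last exact: Rle_refl.
  by apply: Rlt_le; apply: ln_increasing => //; apply: pow_lt; Lra.lra.
rewrite /log2; apply: (Rmult_le_reg_r (ln 2)) => //.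
rewrite /Rdiv !Rmult_assoc Rinv_l ?Rmult_1_r; first exact: hln.
exact: Rgt_not_eq.
Qed.

Theorem theorem6 (k D : nat) (hk : (0 < k)%N) (hD : (0 < D)%N)
    (P : 'I_k -> ratfun k) (num den : 'I_k -> ratpoly k)
    (hP : forall i : 'I_k, lowest_terms (P i) (num i) (den i))
    (hdeg : forall i : 'I_k, (ratfun_degree (num i) (den i) <= D)%N)
    (F : nat -> 'I_k -> ratfun k)
    (hF0 : forall i : 'I_k, F 0%N i = ratfun_var i)
    (hwd : forall (n : nat) (i : 'I_k), poly_subst (F n) (den i) != 0)
    (hFS : forall (n : nat) (i : 'I_k),
       F n.+1 i = poly_subst (F n) (num i) / poly_subst (F n) (den i)) :
  exists m : nat,
    (exists (R : ratfun m.+1) (A B : ratpoly m.+1),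
       lowest_terms R A B /\
       forall n : nat,
         let v := fun j : 'I_m.+1 => F (n + j)%N (Ordinal hk) in
         poly_subst v B != 0 /\
         F (n + m + 1)%N (Ordinal hk) = poly_subst v A / poly_subst v B) /\
    (INR m <= INR k + INR k ^ 3 * log2 (INR (k * D)%N))%coqR.
Proof.
pose i0 := Ordinal hk; pose f n := F n i0; pose theta := orbit_value F 1.
pose A := regular F; pose c := @ratfun_const k.
have q_gt0 : (0 < k * D)%N by rewrite muln_gt0 hk hD.
have Ac : forall a, A (c a) := @regular_cst k F.
have AD : forall x y, A x -> A y -> A (x + y) := @regularD k F.
have AM : forall x y, A x -> A y -> A (x * y) := @regularM k F.
have th : hom_on c A theta := orbit_value_hom F 1.
have tA : forall x, A x -> A (theta x) := @regular_orbit_value k num den F hF0 hwd hFS 1.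
have f0A : A (f 0%N) := proj1 (regular_orbit hF0 hwd hFS 0) i0.
have fS n : f n.+1 = theta (f n) := orbit_shift hF0 hwd hFS n i0.
have fh n : height_le (f n) ((k * D) ^ n) := orbit_height hF0 hwd hFS hdeg n i0.
have [S [M [L [SML hL S_inj [x [y [hx hy y0 xy]]]]]]] :=
  orbit_relation hk q_gt0 Ac AD AM th tA f0A fS fh.
pose m := (S + M)%N.
pose v n (j : 'I_m.+1) := F (n + j)%N i0.
(* Shifting by [n.+1] sends [f (S + i)], [i < M], to the entry of [v n] at index [S + i + 1 <= m],
   and [f (S + M)] to the term [f (n + m + 1)] to be expressed. *)
have hsub : forall z, adj c (initial (fun i => f (S + i)) M) z -> A z /\
    exists p : ratpoly m.+1, forall n, iter n.+1 theta z = poly_subst (v n) p.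
  apply: (adj_ind (T := fun z => A z /\ exists p : ratpoly m.+1,
    forall n, iter n.+1 theta z = poly_subst (v n) p)) => [a|z w|z w|z].
  - split; first exact: Ac.
    exists a%:MP => n; have [-> _ _] := iter_hom th tA n.+1.
    by rewrite poly_substC.
  - move=> [Az [p hp]] [Aw [p' hp']]; split; first exact: AD.
    exists (p + p') => n; have [_ -> // _] := iter_hom th tA n.+1.
    by rewrite hp hp' rmorphD.
  - move=> [Az [p hp]] [Aw [p' hp']]; split; first exact: AM.
    exists (p * p') => n; have [_ _ ->] := iter_hom th tA n.+1 => //.
    by rewrite hp hp' rmorphM.
  - move=> /initialP [i iM ->]; split.
      exact: img_A tA _ _ (g_img tA f0A fS S i).
    have im : (S + i + 1 < m.+1)%N by rewrite /m; lia.
    exists 'X_(Ordinal im) => n.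
    by rewrite -(f_iter fS) poly_substX /v /f /=; congr (F _ _); lia.
have [Ax [p hp]] := hsub x hx; have [Ay [q hq]] := hsub y hy.
have q_neq0 n : poly_subst (v n) q != 0.
  (* The shifted denominator cannot vanish: [y] is a nonzero element of theta^S(A), where [theta] is
     injective. *)
  rewrite -hq; apply: contraNneq y0 => hy0; apply/eqP.
  apply: (img_iter_inj tA S_inj _ hy0).
  exact: (adj_initial_img Ac AD AM th tA f0A fS hy).
have rel n : f (n + m + 1) = poly_subst (v n) (- p) / poly_subst (v n) q.
  have [_ iD iM] := iter_hom th tA n.+1.
  have gA : A (f (S + M)) := img_A tA (g_img tA f0A fS S M).
  have := congr1 (iter n.+1 theta) xy.
  rewrite (hom0 (iter_hom th tA n.+1)) iD //; last exact: AM.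
  rewrite iM // hp hq -(f_iter fS) => /eqP; rewrite addrC addr_eq0 => /eqP e.
  apply: (mulIf (q_neq0 n)); rewrite (divfK (q_neq0 n)) rmorphN -e mulrC.
  by congr (_ * f _); rewrite /m; lia.
have q0 : q != 0 by apply: contraNneq (q_neq0 0%N) => ->; rewrite rmorph0.
(* Passing to lowest terms is harmless along the orbit: the substituted [q] is nonzero, so the
   removed factor [r] does not vanish there either. *)
have [p' [q' [r [q'0 cop p_def q_def]]]] := coprime_reduction (- p) q0.
exists m; split.
  exists (ratfun_of p' / ratfun_of q'), p', q'; split; first by split.
  move=> n /=; have := q_neq0 n; have := rel n.
  rewrite p_def q_def !rmorphM mulf_eq0 negb_or => e /andP [hq' hr].
  split; first exact: hq'.
  by rewrite -[LHS]/(f (n + m + 1)%N) e -mulf_div divff // mulr1.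
have hb : (2 ^ L <= (k * D) ^ (k ^ 3))%N.
  by apply: leq_trans hL (expn_bound hk _); apply: leq_pmulr.
have := pow_le_log2 q_gt0 hb.
have -> : INR (k ^ 3)%N = (INR k ^ 3)%coqR.
  by rewrite !expnS expn0 !mult_INR.
have : (INR m <= INR k + INR L)%coqR.
  by rewrite -plus_INR; apply: le_INR; apply/ssrnat.leP.
Lra.lra.
Qed.
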